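(* Let $X$ be a real Banach space. (1) If $X$ is $C$-weakly sequentially complete for some $C<\frac12$, then $X$ is reflexive. (2) Moreover, the following stronger version holds: if there is $C<\frac12$ such that $$\operatorname{d}(\operatorname{clust}_{X^{**}}(x_k),X)\le C\,\delta(x_k)$$ for each bounded sequence $(x_k)$ in $X$, then $X$ is reflexive.
   Context: All Banach spaces are real, and a Banach space $X$ is regarded as a subspace of its bidual $X^{**}$ via the canonical embedding. For a bounded sequence $(x_k)$ in $X$, $\operatorname{clust}_{X^{**}}(x_k)$ is the set of all weak* cluster points of $(x_k)$ in $X^{**}$, and $\delta(x_k)$ is the (norm) diameter of $\operatorname{clust}_{X^{**}}(x_k)$. For nonempty subsets $A,B$ of a Banach space, $\operatorname{d}(A,B)=\inf\{\|a-b\|: a\in A, b\in B\}$, $\operatorname{d}(a,B)=\operatorname{d}(\{a\},B)$, and $\widehat{\operatorname{d}}(A,B)=\sup\{\operatorname{d}(a,B): a\in A\}$ (distances between subsets of $X^{**}$ are taken in the norm of $X^{**}$). For $C\ge 0$, $X$ is $C$-weakly sequentially complete if $\widehat{\operatorname{d}}(\operatorname{clust}_{X^{**}}(x_k),X)\le C\,\delta(x_k)$ for each bounded sequence $(x_k)$ in $X$. *)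

(* Defs.v *)
From HB Require Import structures.
From mathcomp Require Import all_boot all_order all_algebra.
From mathcomp Require Import all_classical all_reals all_analysis.

Set Implicit Arguments.
Unset Strict Implicit.
Unset Printing Implicit Defensive.

Import Order.TTheory GRing.Theory Num.Theory.
Import numFieldNormedType.Exports.

Local Open Scope classical_set_scope.
Local Open Scope ring_scope.

Section continuous_functionals.
Context {R : realType} {X : normedModType R}.

Definition functional : {pred X -> R^o} :=
  [pred f | `[< linear f /\ continuous f >]].

Lemma functional_submod_closed : submod_closed functional.
Proof.
split.
  rewrite inE; split; last exact: cst_continuous.
  by move=> a u v; rewrite /= scaler0 addr0.
move=> a f g; rewrite !inE => -[lf cf] [lg cg]; split.
  move=> b u v; rewrite !fctE lf lg !scalerDr addrACA !scalerA.
  by rewrite [a * b]mulrC.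
move=> x; apply: cvgD; last exact: cg.
by apply: cvgZr; exact: cf.
Qed.

HB.instance Definition _ :=
  GRing.isSubmodClosed.Build R (X -> R^o) functional functional_submod_closed.

End continuous_functionals.

Record dual {R : realType} (X : normedModType R) := Dual {
  dual_val :> X -> R^o;
  dual_valP : dual_val \in functional }.

Section dual_lmodule.
Context {R : realType} {X : normedModType R}.

HB.instance Definition _ := [isSub for (@dual_val R X)].
HB.instance Definition _ := [Choice of dual X by <:].
HB.instance Definition _ := [SubChoice_isSubLmodule of dual X by <:].

Lemma dual_is_linear (f : dual X) : linear f.
Proof. by have := dual_valP f; rewrite inE => -[]. Qed.

Lemma dual_continuous (f : dual X) : continuous f.
Proof. by have := dual_valP f; rewrite inE => -[]. Qed.

HB.instance Definition _ (f : dual X) :=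
  GRing.isLinear.Build R X R^o *:%R f (dual_is_linear f).

End dual_lmodule.

Section dual_norm.
Context {R : realType} {X : normedModType R}.
Implicit Types f g : dual X.

Definition opnorm f : R := sup [set `|f x| | x in [set x | `|x| <= 1]].

Lemma opnorm_has_sup f : has_sup [set `|f x| | x in [set x | `|x| <= 1]].
Proof.
split; first by exists `|f 0|, 0 => //=; rewrite normr0 ler01.
have /linear_boundedP : bounded_near f (nbhs (0 : X)).
  by apply/linear_bounded_continuous; exact: dual_continuous.
move=> /pinfty_ex_gt0[M M0 fM]; exists M => _ [x /= x1 <-].
by rewrite (le_trans (fM x))// ler_piMr// ltW.
Qed.

Lemma opnorm_ge0 f : 0 <= opnorm f.
Proof.
apply: (@le_trans _ _ `|f 0|) => //; apply: ub_le_sup.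
  by case: (opnorm_has_sup f).
by exists 0 => //=; rewrite normr0 ler01.
Qed.

Lemma opnorm_apply f x : `|f x| <= opnorm f * `|x|.
Proof.
have [->|x0] := eqVneq x 0; first by rewrite linear0 !normr0 mulr0.
have nx0 : 0 < `|x| by rewrite normr_gt0.
rewrite -ler_pdivrMr//.
have -> : `|f x| / `|x| = `|f (`|x|^-1 *: x)|.
  by rewrite linearZ/= normrZ normfV normr_id mulrC.
apply: ub_le_sup; first by case: (opnorm_has_sup f).
by exists (`|x|^-1 *: x) => //=; rewrite normrZ normfV normr_id mulVf// gt_eqF.
Qed.

Lemma opnorm_le f M : 0 <= M -> (forall x, `|f x| <= M * `|x|) -> opnorm f <= M.
Proof.
move=> M0 fM; apply: ge_sup; first by case: (opnorm_has_sup f).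
by move=> _ [x /= x1 <-]; rewrite (le_trans (fM x))// ler_piMr.
Qed.

Lemma opnormD f g : opnorm (f + g) <= opnorm f + opnorm g.
Proof.
apply: opnorm_le => [|x]; first by rewrite addr_ge0// opnorm_ge0.
by rewrite mulrDl (le_trans (ler_normD _ _))// lerD// opnorm_apply.
Qed.

Lemma opnormZ (a : R) f : opnorm (a *: f) = `|a| * opnorm f.
Proof.
have le b h : opnorm (b *: h) <= `|b| * opnorm h.
  apply: opnorm_le => [|x]; first by rewrite mulr_ge0// opnorm_ge0.
  by rewrite [_ x]/(b *: h x) normrZ -mulrA ler_wpM2l// opnorm_apply.
apply/eqP; rewrite eq_le le/=.
have [->|a0] := eqVneq a 0; first by rewrite normr0 mul0r opnorm_ge0.
rewrite -ler_pdivlMl ?normr_gt0//.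
by have := le a^-1 (a *: f); rewrite scalerA mulVf// scale1r normfV.
Qed.

Lemma opnorm0_eq0 f : opnorm f = 0 -> f = 0.
Proof.
move=> f0; apply/val_inj/funext => x; apply/eqP.
by rewrite -normr_le0 (le_trans (opnorm_apply f x))// f0 mul0r.
Qed.

HB.instance Definition _ :=
  Lmodule_isNormed.Build R (dual X) opnormD opnormZ opnorm0_eq0.

End dual_norm.

(* dual X itself carries the operator-norm topology; weak_star X is the same
   type with the topology of pointwise convergence on X (the weak* topology). *)
Definition weak_star {R : realType} (X : normedModType R) : topologicalType :=
  initial_topology (@dual_val R X : dual X -> {ptws X -> R^o}).

Section bidual.
Context {R : realType}.

Definition bidual (X : normedModType R) : normedModType R := dual (dual X).

Lemma evaluation_functional (X : normedModType R) (x : X) :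
  (fun f : dual X => f x : R^o) \in functional.
Proof.
rewrite inE; have lx : linear (fun f : dual X => f x : R^o) by [].
split => //.
pose L := GRing.isLinear.Build R (dual X) R^o *:%R _ lx.
pose ev : {linear dual X -> R^o} := HB.pack (fun f : dual X => f x : R^o) L.
apply: (@bounded_linear_continuous _ _ _ ev); apply/linear_boundedP.
near=> r => f; rewrite mulrC (le_trans (opnorm_apply f x))//.
rewrite ler_wpM2l ?opnorm_ge0//; near: r; exact: nbhs_pinfty_ge.
Unshelve. all: by end_near. Qed.

Definition canonical_embedding (X : normedModType R) (x : X) : bidual X :=
  Dual (evaluation_functional x).

Definition reflexive_space (X : normedModType R) :=
  range (@canonical_embedding X) = setT.

End bidual.

(* Distances are taken in \bar R, so that no infimum or supremum needs a side
   condition; on the nonempty bounded sets of interest they are all finite. *)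
Section distances.
Context {R : realType} {V : normedModType R}.
Implicit Types A B : set V.
Local Open Scope ereal_scope.

Definition set_dist A B : \bar R :=
  ereal_inf [set (`|a - b|%R)%:E | a in A & b in B].

Definition set_excess A B : \bar R :=
  ereal_sup [set set_dist [set a] B | a in A].

Definition diameter A : \bar R :=
  ereal_sup [set (`|a - b|%R)%:E | a in A & b in A].

End distances.

Section weak_sequential_completeness.
Context {R : realType} {X : normedModType R}.
Local Open Scope ereal_scope.

Definition clust (x : nat -> X) : set (bidual X) :=
  @cluster (weak_star (dual X))
    ((fun k => canonical_embedding (x k) : weak_star (dual X)) @ \oo).

Definition delta (x : nat -> X) : \bar R := diameter (clust x).

End weak_sequential_completeness.

Definition weakly_sequentially_complete {R : realType} (C : R)
    (X : normedModType R) :=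
  (0 <= C)%R /\
  forall x : nat -> X, bounded_fun x ->
    (set_excess (clust x) (range (@canonical_embedding R X))
      <= C%:E * delta x)%E.

(* Main.v *)
Require Import Defs.
From HB Require Import structures.
From mathcomp Require Import all_boot all_order all_algebra.
From mathcomp Require Import all_classical all_reals all_analysis.
From mathcomp Require Import ring lra.

(** If ||x_k - x_l|| <= D for all k, l, then delta(x_k) <= D, so for any q with
max(2C, 0) < q < 1 some weak* cluster point of (x_k) is within qD/2 of a point
a of X; by Hahn-Banach the convex hull of every tail of (x_k) then meets the
ball of radius qD/2 around a. This yields convex combinations y_k of the tails
with ||y_k - y_l|| <= qD, and iterating gives convex combinations of the tails
of any given bounded sequence with mutual distances as small as desired. In a
nonreflexive space this fails for a James sequence: pick z in X** at distance
d > 0 from X and, by Helly's theorem, alternately functionals f_n in the unit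
ball that are small on x_k for k < n with z(f_n) close to d, and bounded points
x_n with f_i(x_n) close to z(f_i) for i <= n; then f_n separates the convex
hulls of (x_k)_(k<n) and (x_k)_(k>=n) by a gap independent of n. *)

Set Implicit Arguments.
Unset Strict Implicit.
Unset Printing Implicit Defensive.

Import Order.TTheory GRing.Theory Num.Theory.
Import numFieldNormedType.Exports.

Local Open Scope classical_set_scope.
Local Open Scope ring_scope.

(** * Convex sets and convex hulls *)

Section convex_sets.
Context {R : realType} {V : lmodType R}.

Lemma convex_setP (A : set (convex_lmodType V)) : convex_set A <->
  forall (x y : V) (t : R), A x -> A y -> 0 <= t <= 1 ->
    A (t *: x + (1 - t) *: y).
Proof.
split=> [cA x y t Ax Ay t01|cA x y t /set_mem Ax /set_mem Ay].
  have t01' : Itv.spec (@Itv.num_sem R) (Itv.Real `[0%Z, 1%Z]) t.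
    by rewrite /= /Itv.num_sem/= in_itv/= num_real.
  exact: (set_mem (cA _ _ (Itv.mk t01') (mem_set Ax) (mem_set Ay))).
by apply/mem_set/cA => //; rewrite ge0 le1.
Qed.

Lemma convex_set1 (v : V) : @convex_set R V [set v].
Proof.
apply/convex_setP => _ _ t -> -> _.
by rewrite /= -scalerDl addrC subrK scale1r.
Qed.

Definition convex_hull (A : set V) : set V :=
  \bigcap_(K in [set K : set (convex_lmodType V) | convex_set K /\ A `<=` K]) K.

End convex_sets.

(** * Sublinear functionals and the Mazur-Orlicz theorem *)

Section sublinear_functionals.
Context {R : realType} {V : lmodType R}.
Implicit Types (p q : V -> R) (u v x : V).

Definition sublinear q :=
  (forall u v, q (u + v) <= q u + q v) /\
  (forall (t : R) v, 0 <= t -> q (t *: v) = t * q v).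

Lemma sublinear0 q : sublinear q -> q 0 = 0.
Proof. by move=> [_ qZ]; rewrite -(scale0r (0 : V)) qZ// mul0r. Qed.

Lemma sublinear_ge q v : sublinear q -> - q (- v) <= q v.
Proof.
by move=> sq; have := sq.1 v (- v); rewrite subrr sublinear0// => ?; lra.
Qed.

(** The tilt is [p v], the infimum of [q (v + t *: k) - t * r] over [t >= 0] and [k] in [K]; it is
    finite because [t * r <= t * q k <= q (v + t *: k) + q (- v)]. A linear functional below [p] is
    below [q] and, by the bound at [- k], at least [r] on [K]. *)
Lemma sublinear_tilt q (K : set (convex_lmodType V)) (r : R) :
  sublinear q -> convex_set K -> K !=set0 -> (forall k, K k -> r <= q k) ->
  exists p, [/\ sublinear p, forall v, p v <= q v &
    forall k : V, K k -> p (- k) <= - r].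
Proof.
move=> sq /convex_setP cK [k0 Kk0] rq; have [qD qZ] := sq.
pose S v := [set q (v + t *: k : V) - t * r | t in [set t | 0 <= t] & k in K].
pose p v := inf (S v).
have Slb v : lbound (S v) (- q (- v)).
  move=> _ [t t0] [k Kk] <-; have := qD (v + t *: k : V) (- v).
  rewrite addrAC subrr add0r qZ// => ?.
  have : t * r <= t * q k by rewrite ler_wpM2l// rq.
  lra.
have Sq v : S v (q v).
  by exists 0 => //=; exists k0; rewrite // scale0r addr0 mul0r subr0.
have p_le v (s : R) : S v s -> p v <= s.
  by apply: ge_inf; exists (- q (- v)); exact: Slb.
have p_ge v (s : R) : lbound (S v) s -> s <= p v.
  by apply: lb_le_inf; exists (q v).
have pq v : p v <= q v by exact: p_le.
have p0 : p 0 = 0.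
  apply/eqP; rewrite eq_le -{1}(sublinear0 sq) pq/=.
  by rewrite (le_trans _ (p_ge _ _ (Slb 0)))// oppr0 sublinear0// oppr0.
have pZle (t : R) v : 0 < t -> p (t *: v) <= t * p v.
  move=> t0; rewrite -ler_pdivrMl//; apply: (p_ge _ _) => _ [s s0] [k Kk] <-.
  rewrite ler_pdivrMl//; apply: p_le; exists (t * s);
    first exact: mulr_ge0 (ltW _) _.
  by exists k => //; rewrite mulrBr -qZ ?ltW// scalerDr scalerA mulrA.
exists p; split => //; first split.
- move=> u v; rewrite -lerBlDl; apply: (p_ge _ _) => _ [t /= t0] [k Kk] <-.
  rewrite lerBlDl -lerBlDr; apply: (p_ge _ _) => _ [t' /= t'0] [k' Kk'] <-.
  rewrite lerBlDr.
  have [tt'|tt'] := eqVneq (t + t') 0.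
    have -> : t = 0 by lra.
    have -> : t' = 0 by lra.
    rewrite !scale0r !addr0 !mul0r !subr0.
    by rewrite (le_trans (pq _)).
  have tt'0 : 0 < t + t' by rewrite lt_neqAle eq_sym tt' addr_ge0.
  (* Convexity of [K] merges [t *: k + t' *: k'] into [t + t'] times a single point of [K], so one
     member of the infimum set bounds [p (u + v)]. *)
  pose c := t / (t + t').
  have c01 : 0 <= c <= 1.
    by rewrite divr_ge0 ?(ltW tt'0)//= ler_pdivrMr// mul1r lerDl.
  apply: (@le_trans _ _ (q (u + v + (t + t') *: (c *: k + (1 - c) *: k' : V)) -
      (t + t') * r)).
    apply: p_le; exists (t + t'); first exact: ltW.
    by exists (c *: k + (1 - c) *: k') => //; exact: cK.
  have -> : u + v + (t + t') *: (c *: k + (1 - c) *: k' : V) =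
      (u + t' *: k') + (v + t *: k).
    rewrite scalerDr !scalerA mulrBr mulr1 (mulrC _ c) divfK//.
    by rewrite [t + t' - t]addrAC subrr add0r [t *: _ + _]addrC addrACA.
  have := qD (u + t' *: k' : V) (v + t *: k : V); lra.
- move=> t v; rewrite le_eqVlt => /predU1P[<-|t0].
    by rewrite scale0r mul0r p0.
  apply/eqP; rewrite eq_le pZle//= -ler_pdivlMl//.
  have := @pZle t^-1 (t *: v); rewrite invr_gt0 => /(_ t0).
  by rewrite scalerA mulVf ?gt_eqF// scale1r.
- move=> k Kk; apply: p_le; exists 1; first exact: ler01.
  by exists k; rewrite // scale1r addNr sublinear0// mul1r sub0r.
Qed.

(* The tilt along a singleton shows that a minimal sublinear functional is odd,
   hence linear. *)
Lemma minimal_sublinear_linear q : sublinear q ->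
  (forall p, sublinear p -> (forall v, p v <= q v) -> p = q) ->
  linear (q : V -> R^o).
Proof.
move=> sq qmin; have [qD qZ] := sq.
have qN v : q (- v) = - q v.
  have [|k -> //|p [sp pq pv]] :=
    sublinear_tilt (r := q v) sq (@convex_set1 R V v); first by exists v.
  have := pv v erefl; rewrite (qmin p)// => qle.
  by apply/eqP; rewrite eq_le qle/=; have := sublinear_ge v sq; lra.
have qZr (t : R) v : q (t *: v) = t * q v.
  have [t0|t0] := leP 0 t; first exact: qZ.
  by rewrite -[t *: v]opprK -scaleNr qN qZ ?oppr_ge0 ?ltW// mulNr opprK.
move=> a u v; rewrite -[X in _ = X + _]/(a * q u) -qZr; apply/eqP.
rewrite eq_le qD/=.
have := qD (a *: u + v) (- v); rewrite addrK qN; lra.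
Qed.

(** Zorn's lemma for the reversed pointwise order. A nonempty chain is bounded by its pointwise
    infimum, which is finite since every member is at least [- p (- v)] at [v], and subadditive
    since the smaller of two members serves for both arguments. *)
Lemma exists_minimal_sublinear p : sublinear p ->
  exists q, [/\ sublinear q, forall v, q v <= p v &
    forall q', sublinear q' -> (forall v, q' v <= q v) -> q' = q].
Proof.
move=> sp; pose T := {q : V -> R | sublinear q /\ forall v, q v <= p v}.
pose rT (s t : T) := `[< forall v, sval t v <= sval s v >].
have Tlb (s : T) v : - p (- v) <= sval s v.
  case: s => s [/= ss sp']; have := sublinear_ge v ss; have := sp' (- v); lra.
have [||s t /asboolP st /asboolP ts|A Atot|[q [sq qp]] qmax] := @Zorn T rT.
- by move=> t; apply/asboolP => v.
- move=> r s t /asboolP rs /asboolP st; apply/asboolP => v.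
  by rewrite (le_trans (st v)).
- case: s t st ts => [s hs] [t ht] /= st ts; apply/eq_exist/funext => v.
  apply/eqP; rewrite eq_le.
  by rewrite (st v) (ts v).
- have [A0|/set0P[s0 As0]] := eqVneq A set0.
    by exists (exist _ p (conj sp (fun v => lexx (p v)))) => s; rewrite A0.
  pose S v := [set sval s v | s in A].
  pose q v := inf (S v).
  have q_le v s : A s -> q v <= sval s v.
    move=> As; apply: ge_inf; last by exists s.
    by exists (- p (- v)) => _ [s' _ <-]; exact: Tlb.
  have q_ge v (b : R) : lbound (S v) b -> b <= q v.
    by apply: lb_le_inf; exists (sval s0 v), s0.
  have sq : sublinear q.
    split=> [u v|t v t0].
      rewrite -lerBlDl; apply: (q_ge _ _) => _ [s As <-].
      rewrite lerBlDl -lerBlDr; apply: (q_ge _ _) => _ [s' As' <-].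
      rewrite lerBlDr.
      have [/asboolP ss'|/asboolP ss'] := Atot _ _ As As'.
        apply: le_trans (q_le _ _ As') _.
        by have [[+ _] _] := svalP s' => /(_ u v); have := ss' v; lra.
      apply: le_trans (q_le _ _ As) _.
      by have [[+ _] _] := svalP s => /(_ u v); have := ss' u; lra.
    move: t0; rewrite le_eqVlt => /predU1P[<-|t0].
      apply/eqP; rewrite scale0r mul0r eq_le; apply/andP; split.
        by rewrite (le_trans (q_le _ _ As0))// sublinear0//; case: (svalP s0).
      by apply: (q_ge _ _) => _ [s As <-]; rewrite sublinear0//; case: (svalP s).
    have sZ (s : T) : sval s (t *: v) = t * sval s v.
      by have [[_ ->//]] := svalP s; exact: ltW.
    apply/eqP; rewrite eq_le; apply/andP; split.
      rewrite -ler_pdivrMl//; apply: (q_ge _ _) => _ [s As <-].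
      by rewrite ler_pdivrMl// -sZ q_le.
    by apply: (q_ge _ _) => _ [s As <-]; rewrite sZ ler_pM2l// q_le.
  have qp v : q v <= p v.
    by rewrite (le_trans (q_le _ _ As0))//; have [_ ->] := svalP s0.
  exists (exist _ q (conj sq qp)) => s As; apply/asboolP => v; exact: q_le.
- exists q; split => // q' sq' q'q.
  have q'p v : q' v <= p v by rewrite (le_trans (q'q v)).
  have := qmax (exist _ q' (conj sq' q'p)) => /(_ _)/(congr1 sval); apply.
  exact/asboolP.
Qed.

(** Tilting turns the lower bound on [K] into an upper bound on [-K], which survives the passage to
    a minimal sublinear functional below; minimality makes that functional linear. *)
Theorem Mazur_Orlicz p (K : set (convex_lmodType V)) (r : R) :
  sublinear p -> convex_set K -> (forall k, K k -> r <= p k) ->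
  exists f : V -> R^o, [/\ linear f, forall v, f v <= p v &
    forall k, K k -> r <= f k].
Proof.
move=> sp cK rp.
have [q [sq qp qK]] : exists q, [/\ sublinear q, forall v, q v <= p v &
    forall k : V, K k -> q (- k) <= - r].
  have [K0|/set0P K0] := eqVneq K set0; last exact: sublinear_tilt.
  by exists p; split => // k; rewrite K0.
have [f [sf fq fmin]] := exists_minimal_sublinear sq.
have lf := minimal_sublinear_linear sf fmin.
exists f; split => // [v|k Kk]; first by rewrite (le_trans (fq v)).
have := lf (- 1) k 0; rewrite scaleN1r addr0 sublinear0// addr0 scaleN1r => fN.
by rewrite -lerN2 -[leLHS]fN (le_trans (fq _))// qK.
Qed.

End sublinear_functionals.

(** * Separation from a ball and Helly's theorem *)

Section norm_separation.
Context {R : realType}.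

Lemma opnorm_le_upper (V : normedModType R) (f : dual V) (M : R) :
  0 <= M -> (forall v, f v <= M * `|v|) -> opnorm f <= M.
Proof.
move=> M0 fM; apply: opnorm_le => // v; rewrite ler_norml fM andbT lerNl.
by have := fM (- v); rewrite linearN normrN.
Qed.

Lemma bounded_linear_functional (V : normedModType R) (f : V -> R^o) (M : R) :
  linear f -> (forall v, `|f v| <= M * `|v|) -> f \in functional.
Proof.
move=> lf fM; rewrite inE; split => //.
pose L := GRing.isLinear.Build R V R^o *:%R _ lf.
pose g : {linear V -> R^o} := HB.pack f L.
apply: (@bounded_linear_continuous _ _ _ g); apply/linear_boundedP.
exists M; split=> [|N MN v]; first exact: num_real.
by rewrite (le_trans (fM v))// ler_wpM2r// ltW.
Qed.

Lemma norm_separation (V : normedModType R) (K : set (convex_lmodType V))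
    (r : R) : convex_set K -> (forall k : V, K k -> r <= `|k|) ->
  exists f : dual V, opnorm f <= 1 /\ forall k : V, K k -> r <= f k.
Proof.
move=> cK rK; have sublinear_norm : sublinear (fun v : V => `|v|).
  by split=> [|t v t0]; [exact: ler_normD|rewrite normrZ ger0_norm].
have [f [lf fle rf]] := Mazur_Orlicz sublinear_norm cK rK.
have fabs v : `|f v| <= `|v|.
  rewrite ler_norml fle andbT lerNl.
  have := lf (- 1) v 0; rewrite scaleN1r addr0 => fN.
  have f0 : f 0 = 0.
    by have := lf (-1) 0 0; rewrite scaler0 addr0 scaleN1r addNr.
  by move: fN; rewrite f0 addr0 scaleN1r => <-; rewrite -(normrN v).
have ffun : f \in functional.
  by apply: (bounded_linear_functional (M := 1)) => // v; rewrite mul1r.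
exists (Dual ffun); split => //; apply: opnorm_le_upper => // v.
by rewrite mul1r fle.
Qed.

Lemma dual_sumE (V : normedModType R) n (g : 'I_n -> dual V) (a : 'I_n -> R)
    (v : V) :
  (\sum_i a i *: g i : dual V) v = \sum_i a i * g i v.
Proof. by elim/big_rec2 : _ => // i y1 y2 _ <-. Qed.

(** If no such [v] exists, the image of the ball of radius [M] under [v |-> (g i v - c i)] is a
    convex set of row vectors of sup norm at least [e]. A functional separating it from 0 has
    coordinates [a i], and the hypothesis fails for the coefficients [- a i]. *)
Lemma Helly (V : normedModType R) n (g : 'I_n -> dual V) (c : 'I_n -> R)
    (M e : R) : 0 < M -> 0 < e ->
  (forall a : 'I_n -> R, \sum_i a i * c i <= M * opnorm (\sum_i a i *: g i)) ->
  exists v : V, `|v| <= M /\ forall i, `|g i v - c i| < e.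
Proof.
move=> M0 e0 gc; apply: contrapT => nv.
pose h (v : V) : 'rV[R]_n := \row_i (g i v - c i).
pose K : set (convex_lmodType 'rV[R]_n) := h @` [set v | `|v| <= M].
have cK : convex_set K.
  apply/convex_setP => _ _ t [u /= uM <-] [v /= vM <-] /andP[t0 t1].
  exists (t *: u + (1 - t) *: v) => /=.
    rewrite (le_trans (ler_normD _ _))// !normrZ !ger0_norm ?subr_ge0//.
    have -> : M = t * M + (1 - t) * M by ring.
    by rewrite lerD// ler_wpM2l// subr_ge0.
  apply/rowP => i; rewrite !mxE linearD !linearZ/=.
  rewrite -![_ *: (_ : R^o)]/(_ * _); ring.
have eK (k : 'rV[R]_n) : K k -> e <= `|k|.
  move=> [v /= vM <-]; rewrite leNgt; apply/negP => hve.
  apply: nv; exists v; split=> // i; apply: le_lt_trans hve.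
  rewrite [leRHS]mx_normrE.
  by apply: le_trans (le_bigmax _ _ (ord0, i)); rewrite /= mxE.
have [f [_ fK]] := norm_separation cK eK.
pose a i := f (delta_mx 0 i).
pose G : dual V := \sum_i a i *: g i.
have fG v : f (h v) = G v - \sum_i a i * c i.
  rewrite dual_sumE -sumrB [h v]row_sum_delta linear_sum/=.
  apply: eq_bigr => i _.
  by rewrite linearZ/= mxE -[_ *: (_ : R^o)]/(_ * _) mulrC mulrBr.
have GM v : `|v| <= M -> e + \sum_i a i * c i <= G v.
  by move=> vM; rewrite -lerBrDr -fG; apply: fK; exists v.
(* [N] bounds the norm of [- G]: rescale a nonzero [v] to norm [M] and apply [GM]. Then [M * N]
   falls short of the value required by [gc] by exactly [e]. *)
pose N := (- (\sum_i a i * c i) - e) / M.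
have N0 : 0 <= N.
  apply: divr_ge0; last exact: ltW.
  have := GM 0; rewrite normr0 linear0 (ltW M0) => /(_ isT).
  by rewrite -[(0 : R^o)]/(0 : R); lra.
have GN : opnorm (- G) <= N.
  apply: opnorm_le_upper => // v; rewrite -[(- G) v]/(- G v).
  have [->|v0] := eqVneq v 0; first by rewrite linear0 oppr0 normr0 mulr0.
  have nv0 : 0 < `|v| by rewrite normr_gt0.
  have := GM ((M / `|v|) *: v).
  rewrite normrZ gtr0_norm ?divr_gt0// divfK ?gt_eqF// lexx => /(_ isT).
  rewrite linearZ/= -[_ *: (_ : R^o)]/(_ * _) => ?.
  rewrite -(ler_pM2l (divr_gt0 M0 nv0)).
  have -> : M / `|v| * (N * `|v|) = - (\sum_i a i * c i) - e.
    by rewrite /N; field; rewrite ?gt_eqF.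
  lra.
have := gc (fun i => - a i).
have -> : \sum_i - a i *: g i = - G.
  by rewrite /G -sumrN; apply: eq_bigr => i _; rewrite scaleNr.
have -> : \sum_i - a i * c i = - \sum_i a i * c i.
  by rewrite -sumrN; apply: eq_bigr => i _; rewrite mulNr.
have : M * opnorm (- G) <= M * N by rewrite ler_pM2l.
have -> : M * N = - (\sum_i a i * c i) - e by rewrite /N mulrC divfK ?gt_eqF.
lra.
Qed.

End norm_separation.

(** * The canonical embedding and finite approximation in the bidual *)

Section canonical_embedding_theory.
Context {R : realType} {X : normedModType R}.
Local Notation J := (@canonical_embedding R X).

Lemma canonical_embedding_linear : linear J.
Proof. by move=> a u v; apply/val_inj/funext => f; exact: (dual_is_linear f). Qed.

HB.instance Definition _ :=
  GRing.isLinear.Build R X (bidual X) *:%R J canonical_embedding_linear.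

Lemma norm_canonical_embedding (x : X) : `|J x| = `|x|.
Proof.
apply/eqP; rewrite eq_le; apply/andP; split.
  by apply: opnorm_le => // f; rewrite mulrC; exact: (opnorm_apply f x).
have [|f [f1 fx]] := norm_separation (r := `|x|) (@convex_set1 R X x).
  by move=> _ ->.
rewrite (le_trans (fx x erefl))// (le_trans (ler_norm _))//.
by rewrite (le_trans (opnorm_apply (J x) f))// ler_piMr// opnorm_ge0.
Qed.

(** Helly's condition holds because [z] is linear: the combination of the values [z s_i] is [z] at
    the combination of the [s_i]. The summand 1 keeps the radius positive when [z = 0]. *)
Lemma Goldstine (z : bidual X) (e : R) (s : seq (dual X)) : 0 < e ->
  exists x : X, `|x| <= `|z| + 1 /\ forall f, f \in s -> `|f x - z f| < e.
Proof.
move=> e0.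
have z1 : 0 < `|z| + 1 by rewrite ltr_wpDl.
have [|x [xM xs]] := @Helly R X _ (fun i : 'I_(size s) => s`_i)
  (fun i => z s`_i) _ _ z1 e0.
  move=> a; set G := \sum_i a i *: s`_i.
  have -> : \sum_i a i * z s`_i = z G.
    by rewrite linear_sum; apply: eq_bigr => i _; rewrite linearZ.
  rewrite (le_trans (ler_norm _))// (le_trans (opnorm_apply z G))//.
  by rewrite ler_wpM2r// lerDl.
exists x; split=> // f fs; have := fs; rewrite -index_mem => ifs.
by have := xs (Ordinal ifs); rewrite /= nth_index.
Qed.

(** Helly's theorem in the dual space, prescribing the value 0 at the points of [s] and [d] at [z].
    For a coefficient [b > 0] of [z], the combination is [b] times [z] minus a point of X, so its
    norm is at least [b * d]. *)
Lemma exists_functional_away (z : bidual X) (d e : R) (s : seq X) :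
  0 <= d -> 0 < e -> (forall x, d <= `|z - J x|) ->
  exists f : dual X, [/\ opnorm f <= 1, `|z f - d| < e &
    forall x, x \in s -> `|f x| < e].
Proof.
move=> d0 e0 dz.
(* The default value of [nth] makes [z] the entry of index [size s]. *)
pose g i : bidual X := nth z (map J s) i.
pose c i := if (i < size s)%N then 0 else d.
have gE i : (i < size s)%N -> g i = J s`_i by move=> ?; rewrite /g (nth_map 0).
have gz : g (size s) = z by rewrite /g nth_default// size_map.
have [|f [f1 fs]] := @Helly R (dual X) (size s).+1 (fun i => g i)
  (fun i => c i) _ _ ltr01 e0.
  move=> a; rewrite mul1r !big_ord_recr/= gz {2}/c ltnn big1 ?add0r; last first.
    by move=> i _; rewrite /c/= ltn_ord mulr0.
  set b := a ord_max.
  have [b0|b0] := leP b 0.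
    by apply: (@le_trans _ _ 0); [rewrite mulr_le0_ge0|exact: opnorm_ge0].
  set S := \sum_(i < _) _.
  have -> : S = J (\sum_(i < size s) a (widen_ord (leqnSn _) i) *: s`_i).
    rewrite linear_sum; apply: eq_bigr => i _.
    by rewrite linearZ/= gE.
  set y := \sum_(i < _) _.
  have -> : J y + b *: z = b *: (z - J (- b^-1 *: y)).
    by rewrite scalerBr -linearZ/= scalerA mulrN mulfV ?gt_eqF// scaleN1r
      linearN opprK addrC.
  by rewrite opnormZ gtr0_norm// ler_pM2l// dz.
exists f; split => //.
- by have := fs ord_max; rewrite /= gz /c ltnn.
- move=> x xs; have := xs; rewrite -index_mem => ixs.
  have := fs (widen_ord (leqnSn _) (Ordinal ixs)).
  by rewrite /= gE// /c ixs subr0 nth_index.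
Qed.

End canonical_embedding_theory.

(** * Hulls of sequences and half-spaces *)

Section convex_hull_theory.
Context {R : realType} {V : lmodType R}.
Implicit Types A B K : set V.

Lemma sub_convex_hull A : A `<=` convex_hull A.
Proof. by move=> v Av K [_]; exact. Qed.

Lemma convex_hull_min A (K : set (convex_lmodType V)) :
  convex_set K -> A `<=` K -> convex_hull A `<=` K.
Proof. by move=> cK AK v; apply. Qed.

Lemma convex_convex_hull A : @convex_set R V (convex_hull A).
Proof.
apply/convex_setP => u v t Au Av t01 K [cK AK].
exact: (convex_setP K).1 cK _ _ _ (Au K (conj cK AK)) (Av K (conj cK AK)) t01.
Qed.

Lemma convex_hullS A B : A `<=` B -> convex_hull A `<=` convex_hull B.
Proof.
move=> AB; apply: convex_hull_min; first exact: convex_convex_hull.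
by move=> v /AB; exact: sub_convex_hull.
Qed.

(** A convex combination uses finitely many terms: the hulls of the initial segments increase, so
    their union is already convex. *)
Lemma convex_hull_seq (x : nat -> V) (A : set nat) :
  convex_hull (x @` A) `<=`
  \bigcup_n convex_hull (x @` [set k | A k /\ (k < n)%N]).
Proof.
apply: convex_hull_min => [|_ [k Ak <-]]; last first.
  by exists k.+1 => //; apply: sub_convex_hull; exists k => /=.
apply/convex_setP => u v t [m _ um] [n _ vn] t01.
exists (maxn m n) => //; set B := x @` _.
have /convex_setP cB := @convex_convex_hull B; apply: cB => //.
- apply: convex_hullS um => _ [k /= [Ak km] <-]; exists k => //=.
  by rewrite leq_max km.
- apply: convex_hullS vn => _ [k /= [Ak kn] <-]; exists k => //=.
  by rewrite leq_max kn orbT.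
Qed.

End convex_hull_theory.

Section halfspaces.
Context {R : realType} {X : normedModType R}.

Lemma convex_halfspace_le (f : dual X) (a : R) :
  @convex_set R X [set v | f v <= a].
Proof.
apply/convex_setP => u v t /= ua va /andP[t0 t1].
rewrite linearD !linearZ/= -![_ *: (_ : R^o)]/(_ * _).
have -> : a = t * a + (1 - t) * a by ring.
by rewrite lerD// ler_wpM2l// subr_ge0.
Qed.

Lemma convex_halfspace_ge (f : dual X) (a : R) :
  @convex_set R X [set v | a <= f v].
Proof.
have -> : [set v | a <= f v] = [set v | (- f : dual X) v <= - a].
  apply/seteqP; split=> v va.
    by have : - f v <= - a by rewrite lerN2; exact: va.
  by have : - f v <= - a := va; rewrite lerN2.
exact: convex_halfspace_le.
Qed.

Lemma convex_halfspace_gap (f : dual X) (A B : set X) (a b : R) :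
  opnorm f <= 1 -> (forall u, A u -> f u <= a) -> (forall v, B v -> b <= f v) ->
  forall u v, convex_hull A u -> convex_hull B v -> b - a <= `|v - u|.
Proof.
move=> f1 fA fB u v Au Bv.
have fu : f u <= a := convex_hull_min (@convex_halfspace_le f a) fA Au.
have fv : b <= f v := convex_hull_min (@convex_halfspace_ge f b) fB Bv.
apply: (@le_trans _ _ (f (v - u))); first by rewrite linearB/= lerB.
rewrite (le_trans (ler_norm _))// (le_trans (opnorm_apply f _))//.
by rewrite ler_piMl.
Qed.

End halfspaces.

(** * The James sequence in a nonreflexive space *)

Section nonreflexive.
Context {R : realType}.

(** The sets of points whose image is within [e] of [z] generate a filter on X. It is Cauchy because
    the embedding is isometric, and its limit, given by completeness, is sent to [z]. *)
Lemma canonical_embedding_closed (X : completeNormedModType R) (z : bidual X) :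
  (forall e : R, 0 < e -> exists x : X, `|z - canonical_embedding x| < e) ->
  range (@canonical_embedding R X) z.
Proof.
move=> zX.
pose F : set_system X := [set A | exists2 e : R, 0 < e &
  forall x, `|z - canonical_embedding x| < e -> A x].
have FP : ProperFilter F.
  split.
    by case=> e e0 F0; have [x /F0] := zX e e0.
  split; first by exists 1.
    move=> A B [e e0 FA] [e' e'0 FB]; exists (Num.min e e').
      by rewrite lt_min e0.
    by move=> x; rewrite lt_min => /andP[/FA Ax /FB Bx].
  by move=> A B AB [e e0 FA]; exists e => // x /FA /AB.
have : cvg F.
  apply/cauchy_cvgP/cauchy_exP => e e0.
  have e20 : 0 < e / 2 by rewrite divr_gt0.
  have [x xe] := zX _ e20; exists x, (e / 2) => // y ye.
  rewrite -ball_normE/= -norm_canonical_embedding linearB/=.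
  rewrite -(subrKA z) (splitr e) (le_lt_trans (ler_normD _ _))// ltrD//.
  by rewrite distrC.
move=> /cvg_ex[/= x Fx]; exists x => //.
apply/esym/eqP; rewrite -subr_eq0 -normr_le0; apply/ler_addgt0Pl => e e0.
rewrite addr0; have e20 : 0 < e / 2 by rewrite divr_gt0.
have [e' e'0 Fe] : F (ball x (e / 2)) by apply: Fx; exact: nbhsx_ballx.
have [|y] := zX (Num.min (e / 2) e'); first by rewrite lt_min e20.
rewrite lt_min => /andP[ye /Fe]; rewrite -ball_normE/= => xy.
rewrite -(subrKA (canonical_embedding y)) (splitr e) (le_trans (ler_normD _ _))//.
by rewrite lerD ?ltW// -linearB norm_canonical_embedding distrC.
Qed.

Lemma nonreflexive_gap_sequence (X : completeNormedModType R) :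
  ~ reflexive_space X ->
  exists (x : nat -> X) (M d : R), [/\ forall k, `|x k| <= M, 0 < d &
    forall n u v, convex_hull (x @` [set k | (k < n)%N]) u ->
      convex_hull (x @` [set k | (n <= k)%N]) v -> d <= `|v - u|].
Proof.
move=> nR.
have [z nz] : exists z, ~ range (@canonical_embedding R X) z.
  by apply: contrapT => /forallNP h; apply: nR; apply/seteqP; split=> // z _;
    exact: contrapT.
have [d [d0 dz]] : exists d : R, 0 < d /\
    forall x, d <= `|z - canonical_embedding x|.
  apply: contrapT => /forallNP h; apply: nz.
  apply: canonical_embedding_closed => e e0.
  apply: contrapT => /forallNP h'; apply: (h e); split=> // x.
  by rewrite leNgt; exact/negP.
(* With tolerance [d / 4], [f n] is at most [d / 4] on earlier points and at least
   [d - d / 4 - d / 4 = d / 2] on later ones, leaving a gap of [d / 4]. *)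
have e0 : 0 < d / 4 by rewrite divr_gt0.
have /choice[F HF] := fun s => exists_functional_away s (ltW d0) e0 dz.
have /choice[G HG] := fun s => Goldstine z s e0.
(* The state lists the points and functionals chosen so far. The new functional sees the old points;
   the new point sees all functionals including the new one, hence the successor in [x n]. *)
pose step (st : seq X * seq (dual X)) :=
  (G (F st.1 :: st.2) :: st.1, F st.1 :: st.2).
pose S n := iter n step ([::], [::]).
pose f n := F (S n).1.
pose x n := G (S n.+1).2.
have S1 n : (S n.+1).1 = x n :: (S n).1 by [].
have S2 n : (S n.+1).2 = f n :: (S n).2 by [].
have xS n k : (k < n)%N -> x k \in (S n).1.
  elim: n => // n IH; rewrite ltnS leq_eqVlt => /predU1P[->|/IH kn].
    by rewrite S1 mem_head.
  by rewrite S1 in_cons kn orbT.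
have fS n k : (k < n)%N -> f k \in (S n).2.
  elim: n => // n IH; rewrite ltnS leq_eqVlt => /predU1P[->|/IH kn].
    by rewrite S2 mem_head.
  by rewrite S2 in_cons kn orbT.
exists x, (`|z| + 1), (d / 4); split => // [k|n u v xu xv].
  by have [] := HG (S k.+1).2.
have [fn1 zf fx] := HF (S n).1.
have -> : d / 4 = d / 2 - d / 4 by field.
apply: (convex_halfspace_gap fn1 _ _ xu xv) => [_ [k /= kn <-]|_ [k /= nk <-]].
  by have := fx _ (xS _ _ kn); rewrite ltr_norml => /andP[_ /ltW].
have [_ /(_ (f n))] := HG (S k.+1).2.
rewrite fS// => /(_ isT); move: zf; rewrite !ltr_norml -/(f n) -/(x k).
by move=> /andP[? ?] /andP[? ?]; lra.
Qed.

End nonreflexive.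

(** * Existence and testing of weak* cluster points *)

Section weak_star_cluster_points.
Context {R : realType} {X : normedModType R}.
Implicit Types (x : nat -> X) (z : bidual X).

Lemma clust_adherent x z (f : dual X) (e : R) n : clust x z -> 0 < e ->
  exists2 k, (n <= k)%N & `|f (x k) - z f| < e.
Proof.
move=> xz e0.
pose A : set (weak_star (dual X)) :=
  (fun k => canonical_embedding (x k) : weak_star (dual X)) @` [set k | (n <= k)%N].
pose B : set (weak_star (dual X)) := [set w | ball (z f : R) e ((w : bidual X) f)].
have [||w [[k /= nk <-] ]] := xz A B.
- by exists n => // k /= nk; exists k.
- have cf : continuous (fun w : weak_star (dual X) => (w : bidual X) f).
    move=> w; apply: (@continuous_comp _ _ _
      (@dual_val R (dual X) : weak_star (dual X) -> {ptws (dual X) -> R^o})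
      (fun g : {ptws (dual X) -> R^o} => g f)).
      exact: initial_continuous.
    exact: (@proj_continuous _ (fun=> R^o) f).
  by apply: cf; exact: nbhsx_ballx.
- by rewrite /B/= -ball_normE/= distrC => ?; exists k.
Qed.

(** Along an ultrafilter finer than [\oo], each bounded real sequence [f (x k)] converges. The
    limits depend linearly on [f] with bound [M], and the resulting element of the bidual is a weak*
    cluster point. *)
Lemma clust_nonempty x : bounded_fun x -> clust x !=set0.
Proof.
move=> /pinfty_ex_gt0[M M0 xM].
have {}xM k : `|x k| <= M by exact: xM.
have [U [UU oU]] := ultraFilterLemma eventually_filter.
have UP := @ultra_proper _ _ UU.
have fcvg (f : dual X) : exists l : R, `|l| <= M * `|f| /\
    (fun k => f (x k) : R) @ U --> l.
  have fM k : f (x k) \in `[- (M * `|f|), M * `|f|].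
    rewrite in_itv/= -ler_norml (le_trans (opnorm_apply f _))// mulrC.
    by rewrite ler_wpM2r// opnorm_ge0.
  have [|l [/= lM fl]] := @segment_compact R (- (M * `|f|)) (M * `|f|)
    ((fun k => f (x k) : R) @ U) _.
    by apply: (@filterE _ U) => k; exact: fM.
  exists l; split; first by move: lM; rewrite in_itv/= -ler_norml.
  move=> B lB.
  (* A cluster point of an ultrafilter is its limit: otherwise the complement of the neighbourhood
     [B] would belong to the image filter and have to meet [B]. *)
  have [//|UnB] := in_ultra_setVsetC ((fun k => f (x k)) @^-1` B) UU.
  by have [y []] := fl (~` B) B UnB lB.
have /choice[L HL] := fcvg.
have linL : linear (L : dual X -> R^o).
  move=> a f g.
  apply: (@cvg_unique _ (@Rhausdorff R) ((fun k => (a *: f + g) (x k) : R) @ U)).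
    exact: (HL _).2.
  apply: cvgD; last exact: (HL g).2.
  by apply: cvgMr; exact: (HL f).2.
have Lfun : (L : dual X -> R^o) \in functional.
  by apply: (bounded_linear_functional linL) => f; exact: (HL f).1.
exists (Dual Lfun) => A B xA [C [[D oD <-] DL] CB].
have UD : ((fun k => canonical_embedding (x k) : dual X -> R^o) @ U) D.
  have /pointwise_cvgP : forall f, (fun g : dual X -> R^o => g f) @
      ((fun k => canonical_embedding (x k) : dual X -> R^o) @ U) --> L f.
    by move=> f; exact: (HL f).2.
  by apply; exact: open_nbhs_nbhs.
have UA : U [set k | A (canonical_embedding (x k))] by exact: oU.
have {}UD : U [set k | D (canonical_embedding (x k) : dual X -> R^o)] by [].
have [k [Ak Dk]] := filter_ex (filterI UA UD).
by exists (canonical_embedding (x k)); split => //; exact: CB.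
Qed.

End weak_star_cluster_points.

(** * Cluster sets and the contraction step *)

Section cluster_sets.
Context {R : realType} {X : normedModType R}.
Implicit Types (x y : nat -> X) (z : bidual X).

Lemma clust_dist_le x z z' (D : R) : (forall k l, `|x k - x l| <= D) ->
  clust x z -> clust x z' -> `|z - z'| <= D.
Proof.
move=> xD xz xz'; have D0 : 0 <= D by rewrite (le_trans _ (xD 0 0)).
apply: opnorm_le => // f; apply/ler_addgt0Pr => e e0.
have e20 : 0 < e / 2 by rewrite divr_gt0.
have [k _ fk] := clust_adherent f 0 xz e20.
have [l _ fl] := clust_adherent f 0 xz' e20.
have fkl : `|f (x k) - f (x l)| <= D * `|f|.
  rewrite -linearB (le_trans (opnorm_apply f _))// mulrC.
  by rewrite ler_wpM2r// opnorm_ge0.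
rewrite distrC in fk.
have -> : (z - z') f = (z f - f (x k)) + (f (x k) - f (x l)) + (f (x l) - z' f).
  by rewrite !subrKA.
have := ler_normD (z f - f (x k) + (f (x k) - f (x l))) (f (x l) - z' f).
have := ler_normD (z f - f (x k)) (f (x k) - f (x l)).
lra.
Qed.

Lemma delta_le x (D : R) : (forall k l, `|x k - x l| <= D) ->
  (delta x <= D%:E)%E.
Proof.
move=> xD; apply: ge_ereal_sup => _ [z xz] [z' xz'] <-.
by rewrite lee_fin; exact: clust_dist_le xz xz'.
Qed.

Lemma delta_ge0 x : bounded_fun x -> (0 <= delta x)%E.
Proof.
move=> /clust_nonempty[z xz]; apply: ereal_sup_ubound.
by exists z => //; exists z => //; rewrite subrr normr0.
Qed.

(** Boundedness supplies a cluster point; for an empty cluster set the infimum would be [+oo] and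
    the supremum [-oo]. *)
Lemma set_dist_le_excess x (B : set (bidual X)) : bounded_fun x ->
  (set_dist (clust x) B <= set_excess (clust x) B)%E.
Proof.
move=> /clust_nonempty[z xz].
apply: (@le_trans _ _ (set_dist [set z] B)).
  by apply: ereal_inf_le_tmp => _ [_ -> [b Bb <-]]; exists z => //; exists b.
by apply: ereal_sup_ubound; exists z.
Qed.

(* If the convex hull of a tail of [x] avoided the open ball of radius [r]
   around [a], a norm-one functional would separate them, and evaluating the
   cluster point at that functional would contradict its distance to [a]. *)
Lemma clust_convex_combinations x z (a : X) (r : R) :
  clust x z -> `|z - canonical_embedding a| < r ->
  exists y : nat -> X, forall k,
    convex_hull (x @` [set j | (k <= j)%N]) (y k) /\ `|y k - a| < r.
Proof.
move=> xz zr.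
suff /choice[y xy] : forall k, exists y : X,
    convex_hull (x @` [set j | (k <= j)%N]) y /\ `|y - a| < r by exists y.
move=> k; apply: contrapT => /forallNP nk.
set H := convex_hull _ in nk.
pose K : set (convex_lmodType X) := [set v : X | H (v + a)].
have cK : convex_set K.
  have /convex_setP cH : @convex_set R X H by exact: convex_convex_hull.
  apply/convex_setP => u v t Ku Kv t01; rewrite /K/=.
  have -> : t *: u + (1 - t) *: v + a = t *: (u + a) + (1 - t) *: (v + a).
    by rewrite !scalerDr addrACA -scalerDl subrKC scale1r.
  exact: cH.
have rK (v : X) : K v -> r <= `|v|.
  move=> Kv; rewrite leNgt; apply/negP => vr; apply: (nk (v + a)).
  by rewrite addrK.
have [f [f1 fK]] := norm_separation cK rK.
have e0 : 0 < r - `|z - canonical_embedding a| by rewrite subr_gt0.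
have [j kj] := clust_adherent f k xz e0.
rewrite ltr_norml => /andP[_ fj].
have : r <= f (x j - a).
  by apply: fK; rewrite /K/= subrK; apply: sub_convex_hull; exists j.
rewrite linearB/= => rf.
have : z f - f a <= `|z - canonical_embedding a|.
  rewrite (le_trans (ler_norm _))//.
  rewrite (le_trans (opnorm_apply (z - canonical_embedding a) f))//.
  by rewrite ler_piMr// opnorm_ge0.
by lra.
Qed.

(** The factor is the midpoint between [2 * Num.max C 0] and 1. It is below 1, while half of it
    strictly exceeds [Num.max C 0], so some cluster point is closer than [q * D / 2] to X. *)
Lemma convex_combinations_contract x (C D : R) : 0 < D ->
  (forall k l, `|x k - x l| <= D) ->
  (set_dist (clust x) (range (@canonical_embedding R X)) <= C%:E * delta x)%E ->
  bounded_fun x -> C < 1 / 2 ->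
  exists y : nat -> X,
    (forall k, convex_hull (x @` [set j | (k <= j)%N]) (y k)) /\
    forall k l, `|y k - y l| <= (1 / 2 + Num.max C 0) * D.
Proof.
move=> D0 xD xC bx C2; set q := 1 / 2 + _.
(* A negative [C] is replaced by 0, so that the bound on [delta x] can be multiplied through. *)
have C0 : (C%:E * delta x <= (Num.max C 0 * D)%:E)%E.
  rewrite EFinM; apply: (@le_trans _ _ ((Num.max C 0)%:E * delta x)%E).
    by rewrite lee_wpmul2r ?delta_ge0// lee_fin le_max lexx.
  by rewrite lee_wpmul2l ?delta_le// lee_fin le_max lexx orbT.
have : (set_dist (clust x) (range (@canonical_embedding R X)) < (q * D / 2)%:E)%E.
  rewrite (le_lt_trans xC)// (le_lt_trans C0)// lte_fin.
  have -> : q * D / 2 = q / 2 * D by ring.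
  rewrite ltr_pM2r// /q; case: (leP C 0) => ?; lra.
move=> /ereal_inf_lt[_ [z xz [_ [a _ <-]] <-]]; rewrite lte_fin => zr.
have [y xy] := clust_convex_combinations xz zr.
exists y; split=> [k|k l]; first by case: (xy k).
rewrite -(subrKA a) (splitr (q * D)) (le_trans (ler_normD _ _))// lerD//.
  by have [_ /ltW] := xy k.
by rewrite distrC; have [_ /ltW] := xy l.
Qed.

Lemma bounded_dist_bounded_fun x (D : R) :
  (forall k l, `|x k - x l| <= D) -> bounded_fun x.
Proof.
move=> xD; exists (`|x 0| + D); split=> [|M MD k _ /=]; first exact: num_real.
rewrite -(subrK (x 0) (x k)) (le_trans (ler_normD _ _))// addrC.
by rewrite (le_trans _ (ltW MD))// lerD.
Qed.

End cluster_sets.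

(** * Iteration and conclusion *)

Lemma quantitative_wsc_reflexive (R : realType) (X : completeNormedModType R)
    (C : R) : C < 1 / 2 ->
  (forall x : nat -> X, bounded_fun x ->
    (set_dist (clust x) (range (@canonical_embedding R X))
      <= C%:E * delta x)%E) ->
  reflexive_space X.
Proof.
move=> C2 XC; apply: contrapT => /nonreflexive_gap_sequence.
move=> [x [M [d [xM d0 gap]]]].
have M0 : 0 <= M by rewrite (le_trans _ (xM 0)).
set q := 1 / 2 + Num.max C 0.
have q0 : 0 < q by rewrite /q; case: (leP C 0) => ?; lra.
have q1 : q < 1 by rewrite /q; case: (leP C 0) => ?; lra.
(* [2 * M] bounds the mutual distances of the [x k]; adding 1 makes [D] positive even if [M = 0]. *)
pose D := 2 * M + 1.
have D0 : 0 < D by rewrite /D; lra.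
have xD m : exists y : nat -> X,
    (forall k, convex_hull (x @` [set j | (k <= j)%N]) (y k)) /\
    forall k l, `|y k - y l| <= q ^+ m * D.
  elim: m => [|m [y [xy yD]]].
    exists x; split=> [k|k l]; first by apply: sub_convex_hull; exists k => /=.
    rewrite expr0 mul1r (le_trans (ler_normB _ _))//.
    by have := xM k; have := xM l; rewrite /D; lra.
  have by_ := bounded_dist_bounded_fun yD.
  have [|y' [yy' y'D]] :=
    convex_combinations_contract _ yD (XC y by_) by_ C2.
    by rewrite mulr_gt0// exprn_gt0.
  exists y'; split=> [k|k l]; last by rewrite exprS -mulrA y'D.
  (* Tails are respected: for [j >= k], [y j] lies in the hull of the [x i] with [i >= j], hence in
     that of the tail from [k]. *)
  move: (yy' k); apply: convex_hull_min; first exact: convex_convex_hull.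
  move=> _ [j /= kj <-]; move: (xy j); apply: convex_hullS.
  by move=> _ [i /= ji <-]; exists i => //=; rewrite (leq_trans kj).
have [m qm] : exists m, q ^+ m * D < d.
  have : (fun m => q ^+ m : R) @ \oo --> (0 : R).
    by apply: cvg_expr; rewrite gtr0_norm.
  move=> /cvgr_lt/(_ (d / D)); rewrite divr_gt0// => /(_ isT)[m _ /(_ m)].
  by move=> /(_ (leqnn m)); rewrite ltr_pdivlMr// => ?; exists m.
(* [y 0] involves only finitely many terms, say those of index below [n], while [y n] lies in the
   hull of the tail from [n]; their distance is below [d], against the gap. *)
have [y [xy yD]] := xD m.
have [n _ yn] := convex_hull_seq (xy 0).
have {}yn : convex_hull (x @` [set k | (k < n)%N]) (y 0).
  by apply: convex_hullS yn => _ [k /= [_ kn] <-]; exists k.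
by have := gap n _ _ yn (xy n); rewrite leNgt (le_lt_trans (yD _ _)).
Qed.

Theorem proposition1p2 (R : realType) (X : completeNormedModType R) :
  ((exists C : R, C < 1 / 2 /\ weakly_sequentially_complete C X) ->
    reflexive_space X) /\
  ((exists C : R, C < 1 / 2 /\
      forall x : nat -> X, bounded_fun x ->
        (set_dist (clust x) (range (@canonical_embedding R X))
          <= C%:E * delta x)%E) ->
    reflexive_space X).
Proof.
split=> -[C [C2 XC]]; apply: (quantitative_wsc_reflexive C2) => // x bx.
by rewrite (le_trans (set_dist_le_excess _ bx))//; have [_ ->] := XC.
Qed.
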